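(* Let $n \ge 1$ and let $p(x) = p(x_1,\ldots,x_n)$ be a homogeneous real stable polynomial of degree $n$ in $n$ variables with non-negative real coefficients. If $p(\mathbf{1}) = 1$ and $\|\mathbf{1} - \nabla p(\mathbf{1})\|_1 < 2$, then \[ \inf_{x_1,\ldots,x_n > 0} \frac{p(x)}{x_1 \cdots x_n} \geq \left(1 - \frac{\|\mathbf{1} - \nabla p(\mathbf{1})\|_1}{2}\right)^n . \]
   Context: $\mathbf{1}$ denotes the all-ones vector in $\mathbb{R}^n$, and $\|v\|_1 = \sum_i |v_i|$. A polynomial $p$ with non-negative real coefficients is real stable if $p(x_1,\ldots,x_n) \neq 0$ whenever $x_1,\ldots,x_n$ all lie in the open complex upper half-plane. *)

(* Defs.v *)
From mathcomp Require Import all_boot all_order all_algebra.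
From mathcomp Require Import boolp classical_sets reals.
From mathcomp Require Import complex mpoly.

Set Implicit Arguments.
Unset Strict Implicit.
Unset Printing Implicit Defensive.

Import Order.TTheory GRing.Theory Num.Theory.
Local Open Scope classical_set_scope.
Local Open Scope ring_scope.

(* Vectors of R^n are functions 'I_n -> R, the points at which multinomials'
   polynomials are evaluated. *)

Definition ones (R : realType) (n : nat) : 'I_n -> R := fun=> 1.

Definition l1norm (R : realType) (n : nat) (v : 'I_n -> R) : R :=
  \sum_(i < n) `|v i|.

Definition grad (R : realType) (n : nat) (p : {mpoly R[n]}) (x : 'I_n -> R) :
  'I_n -> R := fun i => (p^`M(i)).@[x].

Definition nonneg_coeffs (R : realType) (n : nat) (p : {mpoly R[n]}) : Prop :=
  forall m : 'X_{1..n}, 0 <= p@_m.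

Definition real_stable (R : realType) (n : nat) (p : {mpoly R[n]}) : Prop :=
  forall z : 'I_n -> R[i], (forall i, 0 < complex.Im (z i)) ->
    (map_mpoly (real_complex R) p).@[z] != 0.

(* When p has non-negative coefficients this set is non-empty and bounded below
   by 0, so inf is its genuine infimum and not the default value. *)
Definition capacity (R : realType) (n : nat) (p : {mpoly R[n]}) : R :=
  inf [set p.@[x] / \prod_(i < n) x i |
        x in [set x : 'I_n -> R | forall i, 0 < x i]].

(* Main.v *)
Require Import Defs.
From mathcomp Require Import all_boot all_order all_fingroup all_algebra.
From mathcomp Require Import boolp classical_sets reals.
From mathcomp Require Import complex mpoly ring lra.

Set Implicit Arguments.
Unset Strict Implicit.
Unset Printing Implicit Defensive.

Import Order.TTheory GRing.Theory Num.Theory.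
Local Open Scope ring_scope.

(* For real [z] the polynomial [p (s 1 + t z)] splits as [\prod_i (s + t l_i)]
   with real [l_i], the eigenvalues of [z].  Write [c] for the gradient of [p]
   at [1], so that [\sum_i l_i = \sum_i c_i z_i].  The key estimate is
   [\sum_i `|l_i| <= \sum_i c_i `|z_i|].  Writing [z = u - w] with [u, w > 0],
   stability gives [`|p (y 1 + i (u - w))| <= `|p (y 1 + i (u + w))|] for real
   [y]; that is, [\prod_i `|y + i l_i| <= \prod_i `|y + i b_i|] where the [b_i]
   are the eigenvalues of [u + w], and this implies
   [\sum_i `|l_i| <= \sum_i b_i = \sum_i c_i (u_i + w_i)].  Finally let
   [u + w] tend to [`|z|].

   Applied to [t 1 - x] with [x > 0], the estimate bounds the sum of the
   positive parts of [t - l_i] by that of [t - x_i] weighted by [c].  Sorting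
   [x] and [l] increasingly and taking [t = x_k], the partial sums of [l]
   dominate those of [(1 - d) x], where [d = || 1 - c ||_1 / 2]; Abel summation
   and the AM-GM inequality then give
   [p x = \prod_i l_i >= (1 - d) ^+ n \prod_i x_i]. *)

(** * Sorting, Abel summation and AM-GM *)

Lemma perm_sorting (R : realDomainType) n (x : 'I_n -> R) :
  exists s : 'S_n, forall i j : 'I_n, (i <= j)%N -> x (s i) <= x (s j).
Proof.
pose t := mktuple x; have /tuple_permP[s ts] : perm_eq (sort <=%R t) t.
  by rewrite perm_sort.
exists s => i j le_ij.
have xs (k : 'I_n) : x (s k) = nth 0 (sort <=%R t) k.
  by rewrite ts (nth_map k) ?size_enum_ord// nth_ord_enum !tnth_mktuple.
rewrite !xs; apply: (le_sorted_leq_nth 0 (sort_le_sorted t)) => //.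
  all: by rewrite inE size_sort size_tuple.
Qed.

Lemma sum_leq_ord_max (V : nmodType) n (F : 'I_n.+1 -> V) :
  \sum_(i < n.+1 | (i <= @ord_max n)%N) F i = \sum_i F i.
Proof. by apply: eq_bigl => i; rewrite leq_ord. Qed.

(** Abel summation: the difference of the two sides combines the partial sums of [a] with the
    nonnegative drops of [w]; the last weight may have any sign. *)
Lemma abel_sum_ge (R : realDomainType) n (w a : 'I_n.+1 -> R) :
  (forall i j : 'I_n.+1, (i <= j)%N -> w j <= w i) ->
  (forall k : 'I_n.+1, 0 <= \sum_(i < n.+1 | (i <= k)%N) a i) ->
  w ord_max * (\sum_i a i) <= \sum_i w i * a i.
Proof.
elim: n w a => [|n IHn] w a w_mono a_ge0.
  by rewrite !big_ord1 (ord1 ord_max).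
rewrite big_ord_recr [leRHS]big_ord_recr /= mulrDr lerD2r.
pose h (i : 'I_n.+1) := widen_ord (leqnSn n.+1) i.
have sumE (k : 'I_n.+1) :
    \sum_(i < n.+1 | (i <= k)%N) a (h i) = \sum_(i < n.+2 | (i <= h k)%N) a i.
  by rewrite [RHS]big_mkcond big_ord_recr /= leqNgt ltn_ord addr0 -big_mkcond.
apply: le_trans (IHn (w \o h) (a \o h) _ _).
- apply: ler_wpM2r; last by apply: w_mono; rewrite /= ltnW.
  by have := a_ge0 (h ord_max); rewrite -sumE sum_leq_ord_max.
- by move=> i j ij /=; apply: w_mono.
- by move=> k; rewrite sumE.
Qed.

(** Abel summation against the decreasing weights [(l i)^-1] bounds the mean of the ratios
    [y i / l i] by 1; AM-GM then bounds their product. *)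
Lemma ler_prod_partial_sum (R : realFieldType) n (l y : 'I_n -> R) :
  (forall i, 0 < l i) -> (forall i, 0 <= y i) ->
  (forall i j : 'I_n, (i <= j)%N -> l i <= l j) ->
  (forall k : 'I_n,
     \sum_(i < n | (i <= k)%N) y i <= \sum_(i < n | (i <= k)%N) l i) ->
  \prod_i y i <= \prod_i l i.
Proof.
case: n l y => [|n] l y l_gt0 y_ge0 l_mono le_sum; first by rewrite !big_ord0.
have le_n : \sum_i y i / l i <= n.+1%:R.
  rewrite -subr_ge0.
  have -> : n.+1%:R - \sum_i y i / l i = \sum_i (l i)^-1 * (l i - y i).
    have -> : n.+1%:R = \sum_(i < n.+1) (1 : R) by rewrite sumr_const card_ord.
    rewrite -sumrB.
    by apply: eq_bigr => i _; rewrite mulrBr mulVf ?gt_eqF// mulrC.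
  apply: le_trans (abel_sum_ge _ _).
  - rewrite mulr_ge0 ?invr_ge0 ?(ltW (l_gt0 _))//.
    by rewrite sumrB subr_ge0; have := le_sum ord_max; rewrite !sum_leq_ord_max.
  - by move=> i j /l_mono; rewrite lef_pV2 ?posrE.
  - by move=> k; rewrite sumrB subr_ge0.
have := (@leif_AGM R 'I_n.+1 predT (fun i => y i / l i) _).1.
rewrite cardT size_enum_ord => le_AGM.
have : \prod_i (y i / l i) <= 1.
  apply: le_trans (le_AGM _) _ => [i _|];
    first by rewrite divr_ge0 ?(ltW (l_gt0 i)).
  rewrite exprn_ile1 ?divr_ge0 ?sumr_ge0// => [i _|].
    by rewrite divr_ge0 ?(ltW (l_gt0 i)).
  by rewrite ler_pdivrMr ?mul1r ?ltr0n.
by rewrite prodf_div ler_pdivrMr ?mul1r// prodr_gt0.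
Qed.

Lemma positive_part_partial_sum (R : realFieldType) n (d : R)
    (x c l : 'I_n -> R) (k : 'I_n) :
  (forall i, 0 < x i) ->
  (forall i j : 'I_n, (i <= j)%N -> x i <= x j) ->
  (forall t, \sum_i Num.max 0 (t - l i) <= \sum_i c i * Num.max 0 (t - x i)) ->
  \sum_i Num.max 0 (c i - 1) <= d ->
  (1 - d) * (\sum_(i < n | (i <= k)%N) x i) <= \sum_(i < n | (i <= k)%N) l i.
Proof.
move=> x_gt0 x_mono le_pos c_le.
have d_ge0 : 0 <= d.
  by apply: le_trans c_le; apply: sumr_ge0 => i _; rewrite le_max lexx.
pose t := x k; pose S (f : 'I_n -> R) := \sum_(i < n | (i <= k)%N) f i.
have S_le f g : (forall i, f i <= g i) -> S f <= S g by move=> ?;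
  apply: ler_sum.
have pos_ge0 (a : R) : 0 <= Num.max 0 a by rewrite le_max lexx.
have le_S_sum f : (forall i, 0 <= f i) -> S f <= \sum_i f i.
  by move=> f_ge0; rewrite /S big_mkcond; apply: ler_sum => i _; case: ifP.
have tlS : S (fun i => t - l i) <= \sum_i Num.max 0 (t - l i).
  apply: le_trans (le_S_sum _ _) => // ; apply: S_le => i.
  by rewrite le_max lexx orbT.
have cxS : \sum_i c i * Num.max 0 (t - x i) = S (fun i => c i * (t - x i)).
  rewrite /S [RHS]big_mkcond; apply: eq_bigr => i _.
  case: leqP => [|/ltnW] /x_mono; rewrite -subr_ge0 => xik.
    by rewrite (max_idPr xik).
  by rewrite (max_idPl _) ?mulr0// -oppr_ge0 opprB.
(* Since [0 <= t - x i <= t], replacing the weight [c i] by 1 costs at most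
   [Num.max 0 (c i - 1) * t]. *)
have cS : S (fun i => c i * (t - x i)) <=
    S (fun i => (t - x i) + Num.max 0 (c i - 1) * t).
  rewrite /S; apply: ler_sum => i /x_mono xit.
  have {}xit : 0 <= t - x i by rewrite subr_ge0.
  have -> : c i * (t - x i) = (t - x i) + (c i - 1) * (t - x i) by ring.
  rewrite lerD2l; apply: (@le_trans _ _ (Num.max 0 (c i - 1) * (t - x i))).
    by rewrite ler_wpM2r// le_max lexx orbT.
  by rewrite ler_wpM2l// gerBl ltW.
have dS : S (fun i => Num.max 0 (c i - 1) * t) <= d * t.
  rewrite /S -mulr_suml ler_wpM2r ?(ltW (x_gt0 k))//.
  by apply: le_trans c_le; apply: le_S_sum.
(* [t = x k] is itself a term of [S x], so the total cost [d * t] is at most [d * S x]. *)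
have tS : t <= S x.
  by rewrite /S (bigD1 k)//= lerDl sumr_ge0// => i _; apply: ltW.
have := le_trans tlS (le_trans (le_pos t) _); rewrite cxS => /(_ _ cS).
rewrite -/(S x) -/(S l) /S sumrB big_split /= sumrB -!/(S _) => le_fin.
have := ler_wpM2l d_ge0 tS; lra.
Qed.

(** Sums and products ignore order, so [x] and [l] are sorted by independent permutations; only [c]
    must travel with [x]. *)
Lemma prod_ge_positive_part (R : realFieldType) n (d : R) (x c l : 'I_n -> R) :
  d < 1 -> (forall i, 0 < x i) -> (forall i, 0 < l i) ->
  (forall t, \sum_i Num.max 0 (t - l i) <= \sum_i c i * Num.max 0 (t - x i)) ->
  \sum_i Num.max 0 (c i - 1) <= d ->
  (1 - d) ^+ n * \prod_i x i <= \prod_i l i.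
Proof.
move=> d_lt1 x_gt0 l_gt0 le_pos c_le.
have [sx sxP] := perm_sorting x; have [sl slP] := perm_sorting l.
rewrite (reindex_inj (@perm_inj _ sx)) [leRHS](reindex_inj (@perm_inj _ sl)) /=.
have -> : (1 - d) ^+ n = \prod_(i < n) (1 - d) by rewrite prodr_const card_ord.
rewrite -big_split /=.
apply: ler_prod_partial_sum => // [i|k].
  by rewrite mulr_ge0 ?ltW// subr_gt0.
rewrite -mulr_sumr.
apply: (@positive_part_partial_sum _ _ _ (x \o sx) (c \o sx) (l \o sl)) => //=.
  move=> t; have := le_pos t.
  by rewrite (reindex_inj (@perm_inj _ sl)) [leRHS](reindex_inj (@perm_inj _
    sx)).
by rewrite (reindex_inj (@perm_inj _ sx)) in c_le.
Qed.

(** * Restriction of a multivariate polynomial to a line *)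

Section Line.
Variables (K : comNzRingType) (n : nat).
Implicit Types (p : {mpoly K[n]}) (a b : 'I_n -> K).

Definition line p a b : {poly K} :=
  \sum_(m <- msupp p) p@_m *: \prod_i ((a i)%:P + b i *: 'X) ^+ m i.

Lemma horner_line p a b s : (line p a b).[s] = p.@[fun i => a i + b i * s].
Proof.
rewrite horner_sum mevalE; apply: eq_bigr => m _.
rewrite hornerZ horner_prod; congr (_ * _); apply: eq_bigr => i _.
by rewrite horner_exp hornerD hornerC hornerZ hornerX.
Qed.

Lemma size_line d p a b : p \is d.-homog -> (size (line p a b) <= d.+1)%N.
Proof.
move=> /dhomogP p_homog; apply: leq_trans (size_sum _ _ _) _.
apply/bigmax_leqP_seq => m m_p _.
apply: leq_trans (size_scale_leq _ _) _.
have <- : mdeg m = d by apply: p_homog.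
rewrite mdegE.
elim/big_ind2: _ => [|d1 q1 d2 q2 le1 le2|i _].
- by rewrite size_poly1.
- apply: leq_trans (size_polyMleq _ _) _.
  by rewrite -subn1 leq_subLR add1n -addSn -addnS leq_add.
- apply: leq_trans (size_poly_exp_leq _ _) _; rewrite ltnS.
  rewrite -[leqRHS]mul1n leq_mul2r -subn1 leq_subLR; apply/orP; right.
  rewrite addrC -mul_polyC size_MXaddC; case: ifP => // _.
  by rewrite ltnS size_polyC leq_b1.
Qed.

Lemma coef1_prod (I : Type) (r : seq I) (F : I -> {poly K}) :
  (forall i, (F i)`_0 = 1) ->
  (\prod_(i <- r) F i)`_1 = \sum_(i <- r) (F i)`_1.
Proof.
move=> F0; have prod0 (s : seq I) : (\prod_(i <- s) F i)`_0 = 1.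
  by rewrite coef0_prod big1.
elim: r => [|i r IHr]; first by rewrite !big_nil coef1.
by rewrite !big_cons coefM !big_ord_recl big_ord0 /= F0 prod0 IHr mul1r mulr1
  addr0 addrC.
Qed.

Lemma meval_deriv_ones p i :
  (p^`M(i)).@[fun=> 1] = \sum_(m <- msupp p) p@_m * (m i)%:R.
Proof.
rewrite {1}[p]mpolyE (raddf_sum (mderiv i)) (raddf_sum (meval _)).
apply: eq_bigr => m _ /=; rewrite mderivZ mderivX !mevalZ mevalX.
by rewrite big1 ?mulr1// => j _; rewrite expr1n.
Qed.

(** The chain rule at 0, checked monomial by monomial: all factors have constant coefficient 1, so
    their linear coefficients add up. *)
Lemma coef1_line p b :
  (line p (fun=> 1) b)`_1 = \sum_i (p^`M(i)).@[fun=> 1] * b i.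
Proof.
under eq_bigr do rewrite meval_deriv_ones mulr_suml.
rewrite exchange_big coef_sum; apply: eq_bigr => m _.
under [RHS]eq_bigr do rewrite -mulrA.
rewrite -mulr_sumr coefZ; congr (_ * _).
have c0 i : ((1%:P + b i *: 'X : {poly K})`_0) = 1.
  by rewrite coefD coefC coefZ coefX mulr0 addr0.
rewrite coef1_prod => [|i]; last first.
  by rewrite -horner_coef0 horner_exp horner_coef0 c0 expr1n.
apply: eq_bigr => i _;
  rewrite -[X in _ ^+ X]card_ord -prodr_const coef1_prod// sumr_const card_ord.
by rewrite coefD coefC coefZ coefX mulr1 add0r mulr_natl.
Qed.

End Line.

Lemma map_line (K L : comNzRingType) (f : {rmorphism K -> L}) n
    (p : {mpoly K[n]}) (a b : 'I_n -> K) :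
  injective f ->
  map_poly f (line p a b) = line (map_mpoly f p) (f \o a) (f \o b).
Proof.
move=> f_inj; rewrite raddf_sum /line (perm_big _ (msupp_map_mpoly p f_inj)) /=.
apply: eq_bigr => m _; rewrite map_polyZ mcoeff_map_mpoly rmorph_prod.
congr (_ *: _); apply: eq_bigr => i _.
by rewrite rmorphXn rmorphD /= map_polyC map_polyZ map_polyX.
Qed.

Lemma meval_map (K L : comNzRingType) (f : {rmorphism K -> L}) n
    (p : {mpoly K[n]}) (v : 'I_n -> K) :
  injective f -> (map_mpoly f p).@[fun i => f (v i)] = f p.@[v].
Proof.
move=> f_inj; rewrite !mevalE (perm_big _ (msupp_map_mpoly p f_inj)) rmorph_sum.
apply: eq_bigr => m _; rewrite mcoeff_map_mpoly rmorphM rmorph_prod.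
by congr (_ * _); apply: eq_bigr => i _; rewrite rmorphXn.
Qed.

(** * Roots of univariate polynomials *)

Lemma poly_eq_pos (K : numDomainType) (q r : {poly K}) :
  (forall s, 0 < s -> q.[s] = r.[s]) -> q = r.
Proof.
move=> eq_qr; apply/eqP; rewrite -subr_eq0; apply/eqP/eqP/negPn/negP => qr0.
(* The integers from 1 to [size (q - r)] are one root too many for a nonzero difference. *)
pose rs : seq K := [seq k.+1%:R | k <- iota 0 (size (q - r))].
have := @max_poly_roots _ (q - r) rs qr0; rewrite size_map size_iota ltnn.
case/(_ _ _)/negP => //; first apply/allP => x /mapP[k _ ->].
  by rewrite rootE hornerD hornerN eq_qr ?subrr.
by rewrite map_inj_uniq ?iota_uniq// => i j /eqP; rewrite eqr_nat => /eqP[].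
Qed.

(** Roots are split off one at a time; a root [a] is nonzero because [q.[0] = 1], so it can be
    normalised to the factor [1 - a^-1 *: 'X]. *)
Lemma real_rooted_factor (R : rcfType) d (q : {poly R}) :
  (size q <= d.+1)%N -> q.[0] = 1 ->
  (forall s : R[i], root (map_poly (real_complex R) q) s -> complex.Im s = 0) ->
  exists l : d.-tuple R, q = \prod_(x <- l) (1 + x *: 'X).
Proof.
elim: d q => [|d IHd] q size_q q0 q_real.
  exists [tuple]; rewrite big_nil.
  by rewrite (size1_polyC size_q) -horner_coef0 q0.
have [size_q1|size_q1] := leqP (size q) 1.
  (* The degree may fall short of the length of the tuple; zeros fill it up. *)
  exists [tuple of nseq d.+1 0]; rewrite big1_seq => [|x /andP[_ /nseqP[-> _]]].
    by rewrite (size1_polyC size_q1) -horner_coef0 q0.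
  by rewrite scale0r addr0.
have /closed_rootP[s s_root] : size (map_poly (real_complex R) q) != 1.
  by rewrite size_map_poly gtn_eqF.
have s_real : s = ((complex.Re s)%:C)%C.
  by move: (q_real _ s_root); case: s {s_root} => a b /= ->.
rewrite s_real fmorph_root in s_root; set a := complex.Re s in s_root.
have a_neq0 : a != 0.
  by apply: contraTneq s_root => ->; rewrite rootE q0 oner_eq0.
have /factor_theorem[r q_fact] := s_root.
have lin_fact : 'X - a%:P = (- a)%:P * (1 + (- a^-1) *: 'X).
  by rewrite -mul_polyC mulrDr mulr1 mulrA -polyCM mulrNN mulfV// mul1r polyCN
    addrC.
rewrite lin_fact mulrA in q_fact.
have r_neq0 : r * (- a)%:P != 0.
  by apply: contraTneq size_q1 => r0; rewrite q_fact r0 mul0r size_poly0.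
have size_lin : size (1 + (- a^-1) *: 'X : {poly R}) = 2.
  by rewrite addrC -mul_polyC size_MXaddC oner_eq0 andbF size_polyC oppr_eq0
    invr_eq0 a_neq0.
have [l r_fact] : exists l : d.-tuple R, r * (- a)%:P = \prod_(x <- l) (1 + x
  *: 'X).
  apply: IHd => [||t t_root].
  - have lin_neq0 : 1 + (- a^-1) *: 'X != 0 :> {poly R} by rewrite
      -size_poly_eq0 size_lin.
    by move: size_q; rewrite q_fact size_mul// size_lin addn2.
  - by move: q0; rewrite q_fact [_.[0]]hornerM [X in _ * X]hornerE hornerZ
      hornerX mulr0 addr0 hornerC mulr1.
  - by apply: q_real; rewrite q_fact rmorphM rootM t_root.
by exists [tuple of - a^-1 :: l]; rewrite big_cons -r_fact mulrC.
Qed.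

(** Factor by factor: a point of the closed lower half-plane is no farther from [-i] than from
    [i]. *)
Lemma norm_horner_conj (R : rcfType) (q : {poly R[i]}) :
  (forall s, root q s -> complex.Im s <= 0) ->
  `|q.[(- 'i)%C]| <= `|q.['i%C]|.
Proof.
move=> q_root; have [rs q_fact] := closed_field_poly_normal q.
have [q_eq0|q_neq0] := eqVneq q 0; first by rewrite q_eq0 !horner0.
rewrite q_fact !hornerZ !horner_prod !normrM !normr_prod ler_wpM2l//.
rewrite !big_seq; apply: ler_prod => s s_rs; rewrite normr_ge0 /=.
have : complex.Im s <= 0.
  by apply: q_root; rewrite q_fact rootZ ?lead_coef_eq0// root_prod_XsubC.
rewrite !hornerXsubC !normc_def lecR; case: s {s_rs} => a b /= b_le0.
apply: ler_wsqrtr; nra.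
Qed.

Lemma horner_even_real (R : rcfType) (r a : R) N :
  ((1 + (r%:C)%C *: 'X) ^+ N + (1 - (r%:C)%C *: 'X) ^+ N).[(a%:C)%C] =
  (((1 + r * a) ^+ N + (1 - r * a) ^+ N)%:C)%C.
Proof.
rewrite !hornerE.
by rewrite rmorphD !rmorphXn rmorphD rmorphB /= !rmorph1 !rmorphM.
Qed.

(** At a root [1 + r s] and [1 - r s] have equal modulus, so [s] is equidistant from the two points
    [1 / r] and [- 1 / r]. *)
Lemma root_even_imaginary (R : rcfType) (r : R) N (s : R[i]) :
  r != 0 -> (0 < N)%N ->
  root ((1 + (r%:C)%C *: 'X) ^+ N + (1 - (r%:C)%C *: 'X) ^+ N) s ->
  complex.Re s = 0.
Proof.
move=> r_neq0 N_gt0; rewrite rootE !hornerE addr_eq0.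
move=> /eqP/(congr1 Num.norm)/eqP; rewrite normrN !normrX eqrXn2//.
case: s => a b; rewrite !normc_def /=.
move=> /eqP/complexI/eqP; rewrite eqr_sqrt ?addr_ge0 ?sqr_ge0//.
move=> /eqP norm_eq; apply: (mulfI r_neq0); rewrite mulr0; nra.
Qed.

(** * From inequalities between products to inequalities between sums *)

Lemma bernoulli_ge (R : realDomainType) (h : R) N :
  0 <= h -> 1 + h *+ N <= (1 + h) ^+ N.
Proof.
move=> h_ge0; elim: N => [|N IHN]; first by rewrite mulr0n addr0.
rewrite exprS; apply: le_trans (ler_wpM2l _ IHN); last by rewrite addr_ge0.
rewrite mulrS -mulr_natr; have := ler0n R N; nra.
Qed.

(** Power trick to discard a constant: if [b < a], Bernoulli makes [(a / b) ^+ N] outgrow [c]. *)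
Lemma ler_expn_asymp (R : archiRealFieldType) (a b c : R) :
  0 <= a -> 0 < b -> (forall N, a ^+ N <= c * b ^+ N) -> a <= b.
Proof.
move=> a_ge0 b_gt0 le_ab; rewrite leNgt; apply/negP => lt_ba.
pose h := a / b - 1.
have h_gt0 : 0 < h by rewrite subr_gt0 ltr_pdivlMr// mul1r.
have c_ge N : 1 + h *+ N <= c.
  apply: le_trans (bernoulli_ge _ (ltW h_gt0)) _.
  by rewrite addrC subrK expr_div_n ler_pdivrMr ?exprn_gt0.
have c_ge0 : 0 <= c by apply: le_trans (c_ge 0%N); rewrite mulr0n addr0.
have := archi_boundP (divr_ge0 c_ge0 (ltW h_gt0)).
set N := Num.bound _; rewrite ltr_pdivrMr// mulr_natl.
have := c_ge N; lra.
Qed.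

Lemma ler_sum_prod1D (R : realDomainType) (I : Type) (s : seq I) (a : I -> R) :
  (forall i, 0 <= a i) -> 1 + \sum_(i <- s) a i <= \prod_(i <- s) (1 + a i).
Proof.
move=> a_ge0; elim: s => [|i s IHs]; first by rewrite !big_nil addr0.
rewrite !big_cons; have S_ge0 : 0 <= \sum_(j <- s) a j by apply: sumr_ge0.
have := a_ge0 i; nra.
Qed.

Lemma prod1D_sum_le1 (R : realDomainType) (I : Type) (s : seq I) (a : I -> R) :
  (forall i, 0 <= a i) ->
  (\prod_(i <- s) (1 + a i)) * (1 - \sum_(i <- s) a i) <= 1.
Proof.
move=> a_ge0; elim: s => [|i s IHs]; first by rewrite !big_nil subr0 mulr1.
rewrite !big_cons; apply: le_trans IHs.
rewrite -mulrA mulrCA ler_wpM2l//.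
  by apply: prodr_ge0 => j _; rewrite addr_ge0.
have S_ge0 : 0 <= \sum_(j <- s) a j by apply: sumr_ge0.
have := a_ge0 i; nra.
Qed.

Lemma ler_sum_of_ler_prod1D (R : realFieldType) (I : Type) (s : seq I)
    (a b : I -> R) :
  (forall i, 0 <= a i) -> (forall i, 0 <= b i) ->
  (forall r, 0 < r ->
     \prod_(i <- s) (1 + r * a i) <= \prod_(i <- s) (1 + r * b i)) ->
  \sum_(i <- s) a i <= \sum_(i <- s) b i.
Proof.
move=> a_ge0 b_ge0 le_ab.
set A := \sum_(i <- s) a i; set B := \sum_(i <- s) b i.
have A_ge0 : 0 <= A by apply: sumr_ge0.
have B_ge0 : 0 <= B by apply: sumr_ge0.
have le1 r : 0 < r -> (1 + r * A) * (1 - r * B) <= 1.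
  move=> r_gt0; have ra_ge0 i : 0 <= r * a i by rewrite mulr_ge0// ltW.
  have rb_ge0 i : 0 <= r * b i by rewrite mulr_ge0// ltW.
  have [rB_lt0|rB_ge0] := ltP (1 - r * B) 0.
    have rA_ge0 : 0 <= r * A by rewrite mulr_ge0// ltW.
    by apply: (@le_trans _ _ 0) => //; rewrite mulr_ge0_le0 ?addr_ge0// ltW.
  have := prod1D_sum_le1 s rb_ge0; rewrite -mulr_sumr; apply: le_trans.
  rewrite ler_wpM2r//; apply: le_trans (le_ab r r_gt0).
  by have := ler_sum_prod1D s ra_ge0; rewrite -mulr_sumr.
rewrite leNgt; apply/negP => lt_BA.
have AB1_gt0 : 0 < A * B + 1 by rewrite ltr_wpDl ?mulr_ge0.
(* [le1] expands to [r * (A - B - r * (A * B)) <= 0]; this [r] makes the bracket equal to [r], so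
   the left side is [r * r > 0]. *)
pose r := (A - B) / (A * B + 1).
have r_gt0 : 0 < r by rewrite divr_gt0 ?subr_gt0.
have rE : r * (A * B + 1) = A - B by rewrite divfK ?gt_eqF.
have : r * (A - B - r * (A * B)) <= 0 by have := le1 r r_gt0; nra.
have -> : A - B - r * (A * B) = r by rewrite -rE; ring.
by rewrite leNgt mulr_gt0.
Qed.

(* The roots of [(1 + r 'X) ^+ 2N + (1 - r 'X) ^+ 2N] are purely imaginary, so
   the hypothesis compares its products over [a] and [b]; letting [N] grow
   replaces it by [(1 + r * `|x|) ^+ 2N], and letting [r] go to 0 gives sums. *)
Lemma ler_sum_of_ler_prod_norm (R : realType) n (a b : 'I_n -> R) :
  (forall i, 0 <= b i) ->
  (forall y : R, \prod_i `|(y +i* a i)%C| <= \prod_i `|(y +i* b i)%C|) ->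
  \sum_i `|a i| <= \sum_i b i.
Proof.
move=> b_ge0 le_norm; apply: ler_sum_of_ler_prod1D => // r r_gt0.
have prod_gt0 (c : 'I_n -> R) :
    (forall i, 0 <= c i) -> 0 < \prod_i (1 + r * c i).
  by move=> c_ge0; rewrite prodr_gt0// => i _; rewrite ltr_wpDr ?mulr_ge0// ltW.
suff le_sqr : (\prod_i (1 + r * `|a i|)) ^+ 2 <= (\prod_i (1 + r * b i)) ^+ 2.
  by rewrite -(@ler_pXn2r _ 2)// nnegrE ltW// prod_gt0.
(* The constant collects a factor 2 per index, from [h (b i) <= 2 * (1 + r * b i) ^+ (2 * N)]. *)
apply: (@ler_expn_asymp _ _ _ (2 ^+ n)) => [||N].
- by rewrite sqr_ge0.
- by rewrite exprn_gt0// prod_gt0.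
have [->|N_gt0] := posnP N.
  by rewrite !expr0 mulr1 exprn_ege1 ?ler1n.
rewrite -!exprM.
pose q : {poly R[i]} :=
  (1 + (r%:C)%C *: 'X) ^+ (2 * N) + (1 - (r%:C)%C *: 'X) ^+ (2 * N).
pose h x := (1 + r * x) ^+ (2 * N) + (1 - r * x) ^+ (2 * N).
have h_ge0 x : 0 <= h x by rewrite addr_ge0// exprM exprn_ge0 ?sqr_ge0.
have le_q : \prod_i `|q.[((a i)%:C)%C]| <= \prod_i `|q.[((b i)%:C)%C]|.
  have [rs q_fact] := closed_field_poly_normal q.
  have [q_eq0|q_neq0] := eqVneq q 0.
    by rewrite q_eq0; apply: ler_prod => i _; rewrite !horner0 normr0 lexx.
  (* A root [s = i v] has distance [|v + i c|] from a real [c], so [le_norm] applies at [y = v], one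
     root at a time. *)
  have normE (c : 'I_n -> R) : \prod_i `|q.[((c i)%:C)%C]| =
      `|lead_coef q| ^+ n * \prod_(s <- rs) \prod_i `|(complex.Im s +i* c i)%C|.
    have -> : `|lead_coef q| ^+ n = \prod_(i < n) `|lead_coef q|.
      by rewrite prodr_const card_ord.
    rewrite exchange_big /= -big_split /=.
    apply: eq_bigr => i _;
      rewrite [q in LHS]q_fact hornerZ horner_prod normrM normr_prod.
    congr (_ * _); rewrite !big_seq; apply: eq_bigr => s s_rs.
    have : complex.Re s = 0.
      apply: (@root_even_imaginary _ r (2 * N)); rewrite ?gt_eqF ?muln_gt0//.
      by rewrite -/q q_fact rootZ ?lead_coef_eq0// root_prod_XsubC.
    rewrite hornerXsubC !normc_def; case: s {s_rs} => u v /= ->.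
    by rewrite subr0 sub0r sqrrN addrC.
  rewrite !normE ler_wpM2l ?exprn_ge0//; apply: ler_prod => s _.
  by rewrite prodr_ge0//= le_norm.
have {le_q} : \prod_i h (a i) <= \prod_i h (b i).
  rewrite -lecR !rmorph_prod.
  have hE (c : 'I_n -> R) i : ((h (c i))%:C)%C = `|q.[((c i)%:C)%C]|.
    by rewrite horner_even_real ger0_norm ?ler0c ?h_ge0.
  by rewrite (eq_bigr _ (fun i _ => hE a i)) [leRHS](eq_bigr _ (fun i _ => hE b
    i)).
(* One of the two even powers in [h (a i)] is [(1 + r * |a i|) ^+ (2 * N)], and the other is
   nonnegative. *)
move=> le_h; rewrite -!prodrXl; apply: le_trans (le_trans _ le_h) _.
- apply: ler_prod => i _;
    rewrite exprn_ge0 ?addr_ge0// ?mulr_ge0 ?(ltW r_gt0)//=.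
  rewrite /h; have [ai_ge0|/ltW ai_le0] := leP 0 (a i).
    by rewrite ger0_norm// lerDl exprM exprn_ge0 ?sqr_ge0.
  by rewrite ler0_norm// mulrN lerDr exprM exprn_ge0 ?sqr_ge0.
- have -> : 2 ^+ n = \prod_(i < n) 2 :> R by rewrite prodr_const card_ord.
  rewrite -big_split /=; apply: ler_prod => i _;
    rewrite h_ge0/= mulr_natl mulr2n lerD2l.
  rewrite !exprM lerXn2r ?nnegrE ?sqr_ge0//.
  have := mulr_ge0 (ltW r_gt0) (b_ge0 i); nra.
Qed.

(* [spectrum p z l]: [l] lists the roots of [t |-> p (t 1 - z)]. *)
Definition spectrum (R : rcfType) n (p : {mpoly R[n]}) (z l : 'I_n -> R) :=
  forall s t : R[i],
    (map_mpoly (real_complex R) p).@[fun i => s + t * ((z i)%:C)%C] =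
    \prod_i (s + t * ((l i)%:C)%C).

Lemma meval_homogZ (K : comNzRingType) n d (p : {mpoly K[n]}) s v :
  p \is d.-homog -> p.@[fun i => s * v i] = s ^+ d * p.@[v].
Proof.
move=> /dhomogP p_homog; rewrite !mevalE mulr_sumr !big_seq.
apply: eq_bigr => m m_p; have <- : mdeg m = d by apply: p_homog.
rewrite mulrCA; congr (_ * _); rewrite mdegE -prodrXr -big_split /=.
by apply: eq_bigr => i _; rewrite exprMn.
Qed.

Lemma dhomog_map (K L : comNzRingType) (f : {rmorphism K -> L}) n d
    (p : {mpoly K[n]}) :
  injective f -> p \is d.-homog -> map_mpoly f p \is d.-homog.
Proof.
move=> f_inj /dhomogP p_homog; apply/dhomogP => m.
by rewrite (perm_mem (msupp_map_mpoly p f_inj)) => /p_homog.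
Qed.

(** * Spectra with respect to a real stable homogeneous polynomial *)

Section Stable.
Variables (R : realType) (n : nat) (p : {mpoly R[n]}).
Hypothesis p_homog : p \is n.-homog.
Hypothesis p_stable : real_stable p.
Hypothesis p_nonneg : nonneg_coeffs p.
Hypothesis p_ones : p.@[@ones R n] = 1.

Let P := map_mpoly (real_complex R) p.
Let realC_inj : injective (real_complex R) := @complexI R.

Let P_homog : P \is n.-homog := dhomog_map realC_inj p_homog.

(** If the sum of nonnegative terms vanished, all coefficients would, against [p_ones]. *)
Lemma meval_gt0 x : (forall i, 0 < x i) -> 0 < p.@[x].
Proof.
move=> x_gt0; have term_ge0 m : 0 <= p@_m * \prod_i x i ^+ m i.
  by rewrite mulr_ge0 ?prodr_ge0// => i _; rewrite exprn_ge0 ?ltW.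
rewrite lt_neqAle [p.@[x]]mevalE sumr_ge0// andbT eq_sym.
apply/negP; rewrite psumr_eq0// => /allP p0.
have : p.@[@ones R n] = 0.
  rewrite mevalE big_seq big1// => m /p0 /=.
  rewrite mulf_eq0 => /orP[/eqP->|]; first by rewrite mul0r.
  by rewrite gt_eqF// prodr_gt0// => i _; rewrite exprn_gt0.
by move/eqP; rewrite p_ones oner_eq0.
Qed.

Lemma stable_Im_lt0 (z : 'I_n -> R[i]) :
  (forall i, complex.Im (z i) < 0) -> P.@[z] != 0.
Proof.
move=> z_lt0; have -> : P.@[z] = (-1) ^+ n * P.@[fun i => - z i].
  rewrite -(meval_homogZ _ _ P_homog); apply: meval_eq => i;
    by rewrite mulN1r opprK.
rewrite mulf_neq0 ?signr_eq0// p_stable// => i.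
by have := z_lt0 i; case: (z i) => a b /=; rewrite oppr_gt0.
Qed.

(** A nonreal root [s] of [p (1 + s z)] would, by homogeneity, give a zero [s^-1 1 + z] whose
    coordinates all share the nonzero imaginary part of [s^-1]; stability excludes both signs. *)
Lemma exists_spectrum z : exists l, spectrum p z l.
Proof.
pose q := line p (@ones R n) z.
have qE : map_poly (real_complex R) q =
    line P (fun=> 1) (fun i => ((z i)%:C)%C).
  by rewrite /q map_line.
have [l l_fact] : exists l : n.-tuple R, q = \prod_(x <- l) (1 + x *: 'X).
  apply: real_rooted_factor.
  - exact: size_line.
  - rewrite horner_line -[RHS]p_ones; apply: meval_eq => i.
    by rewrite mulr0 addr0.
  move=> s; rewrite qE rootE horner_line => Ps0.
  have [//|s_neq0] := eqVneq (complex.Im s) 0.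
  have s0 : s != 0 by apply: contraNneq s_neq0 => ->.
  have Im_inv i : complex.Im (s^-1 + ((z i)%:C)%C) = complex.Im s^-1.
    by case: (s^-1) => a b /=; rewrite addr0.
  have Pinv : P.@[fun i => s^-1 + ((z i)%:C)%C] == 0.
    have /eqP := meval_homogZ s (fun i => s^-1 + ((z i)%:C)%C) P_homog.
    rewrite (@meval_eq _ _ _ (fun i => 1 + ((z i)%:C)%C * s)) => [|i].
      by rewrite (eqP Ps0) eq_sym mulf_eq0 expf_eq0 (negPf s0) andbF.
    by rewrite mulrDr mulfV// mulrC.
  have Im_neq0 : complex.Im s^-1 != 0.
    apply: contra_neq s_neq0 => sV0; rewrite -[s]invrK.
    have -> : s^-1 = ((complex.Re s^-1)%:C)%C by case: (s^-1) sV0 => a b /= ->.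
    by rewrite -fmorphV.
  have [Im_lt|Im_gt|/eqP Im_eq] := ltgtP (complex.Im s^-1) 0.
  - by rewrite (negPf (stable_Im_lt0 _)) // in Pinv => i; rewrite Im_inv.
  - by rewrite (negPf (p_stable _)) // in Pinv => i; rewrite Im_inv.
  - by rewrite Im_eq in Im_neq0.
have P1 t : P.@[fun i => 1 + t * ((z i)%:C)%C] =
    \prod_i (1 + t * ((tnth l i)%:C)%C).
  transitivity (map_poly (real_complex R) q).[t].
    by rewrite qE horner_line; apply: meval_eq => i; rewrite mulrC.
  rewrite l_fact rmorph_prod horner_prod big_tuple; apply: eq_bigr => i _.
  by rewrite rmorphD rmorph1 /= map_polyZ map_polyX !hornerE mulrC.
exists (tnth l) => s t; rewrite -/P.
(* Homogenisation: for positive [u] the factor [u ^+ n] reduces to [P1], and polynomial identity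
   then covers every [s], including 0. *)
have eq_poly : line P (fun i => t * ((z i)%:C)%C) (fun=> 1) =
    \prod_i ('X + (t * ((tnth l i)%:C)%C)%:P).
  apply: poly_eq_pos => u /gt_eqF/negbT u_neq0.
  rewrite horner_line horner_prod.
  rewrite (@meval_eq _ _ _ (fun i => u * (1 + t / u * ((z i)%:C)%C))) => [|i];
    last first.
    by field.
  rewrite (meval_homogZ _ _ P_homog) P1.
  have -> : u ^+ n = \prod_(i < n) u by rewrite prodr_const card_ord.
  rewrite -big_split; apply: eq_bigr => i _ /=.
  by rewrite hornerD hornerX hornerC; field.
rewrite -[RHS](_ : (\prod_i ('X + (t * ((tnth l i)%:C)%C)%:P)).[s] = _);
  last first.
  by rewrite horner_prod; apply: eq_bigr => i _; rewrite !hornerE.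
by rewrite -eq_poly horner_line; apply: meval_eq => i; rewrite mul1r addrC.
Qed.

(** Both sides are the linear coefficient of [p (1 + s z)], the product of the [1 + s l_i]. *)
Lemma spectrum_trace z l :
  spectrum p z l -> \sum_i l i = \sum_i grad p (@ones R n) i * z i.
Proof.
move=> zl; have eq_poly : line p (@ones R n) z = \prod_i (1 + l i *: 'X).
  apply: (map_poly_inj (real_complex R)); apply: poly_eq_pos => s _.
  rewrite map_line// horner_line rmorph_prod horner_prod.
  have := zl 1 s; rewrite (@meval_eq _ _ _ (fun i => 1 + ((z i)%:C)%C * s)) =>
    [->|i].
    apply: eq_bigr => i _.
    by rewrite rmorphD rmorph1 /= map_polyZ map_polyX !hornerE mulrC.
  by rewrite mulrC.
transitivity ((line p (@ones R n) z)`_1); last exact: coef1_line.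
rewrite eq_poly coef1_prod => [|i].
  by apply: eq_bigr => i _; rewrite coefD coef1 coefZ coefX mulr1 add0r.
by rewrite coefD coef1 coefZ coefX mulr0 addr0.
Qed.

(** Euler's identity, obtained as the trace of the all-ones vector, whose eigenvalues are all 1. *)
Lemma sum_grad : \sum_i grad p (@ones R n) i = n%:R.
Proof.
have ones_spec : spectrum p (@ones R n) (@ones R n).
  move=> s t; rewrite -/P.
  have onesE i : s + t * ((@ones R n i)%:C)%C = (s + t) * ((@ones R n i)%:C)%C.
    by rewrite /ones rmorph1 !mulr1.
  rewrite (meval_eq _ onesE) (meval_homogZ _ _ P_homog) meval_map// p_ones
    rmorph1.
  rewrite mulr1 (eq_bigr (fun=> s + t)) ?prodr_const ?card_ord// => i _.
  by rewrite onesE /ones rmorph1 mulr1.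
have := spectrum_trace ones_spec; rewrite sumr_const card_ord => ->.
by apply: eq_bigr => i _; rewrite mulr1.
Qed.

Lemma spectrum_real z l (s : R) :
  spectrum p z l -> p.@[fun i => s + z i] = \prod_i (s + l i).
Proof.
move=> zl; apply: realC_inj; rewrite -meval_map// rmorph_prod.
have := zl (s%:C)%C 1;
  rewrite (@meval_eq _ _ _ (fun i => ((s + z i)%:C)%C)) => [->|i].
  by apply: eq_bigr => i _; rewrite mul1r rmorphD.
by rewrite mul1r rmorphD.
Qed.

(** A negative [l i] would make [p] vanish at [z - l i], a vector with positive entries. *)
Lemma spectrum_ge0 z l :
  spectrum p z l -> (forall i, 0 <= z i) -> forall i, 0 <= l i.
Proof.
move=> zl z_ge0 i; rewrite leNgt; apply/negP => li_lt0.
have := spectrum_real (- l i) zl; rewrite (bigD1 i)//= addNr mul0r => p0.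
have : 0 < p.@[fun j => - l i + z j].
  by apply: meval_gt0 => j; rewrite ltr_wpDr// oppr_gt0.
by rewrite p0 ltxx.
Qed.

(** A root [s] of [p (y 1 + i u + s w)] has [Im s <= 0]: otherwise every coordinate would lie in the
    upper half-plane. The two sides are the values at [s = -i] and [s = i]. *)
Lemma stable_norm_le (u w : 'I_n -> R) (y : R) :
  (forall i, 0 < u i) -> (forall i, 0 <= w i) ->
  `|P.@[fun i => (y +i* (u i - w i))%C]| <= `|P.@[fun i => (y +i* (u i + w
    i))%C]|.
Proof.
move=> u_gt0 w_ge0.
pose q := line P (fun i => (y +i* u i)%C) (fun i => ((w i)%:C)%C).
have -> : P.@[fun i => (y +i* (u i - w i))%C] = q.[(- 'i)%C].
  rewrite horner_line; apply: meval_eq => i; apply/eqP; rewrite eq_complex /=.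
  by apply/andP; split; apply/eqP; ring.
have -> : P.@[fun i => (y +i* (u i + w i))%C] = q.['i%C].
  rewrite horner_line; apply: meval_eq => i; apply/eqP; rewrite eq_complex /=.
  by apply/andP; split; apply/eqP; ring.
apply: norm_horner_conj => s s_root; rewrite leNgt; apply/negP => s_gt0.
move: s_root; rewrite rootE horner_line; apply/negP/p_stable => i.
case: s s_gt0 => a b /= b_gt0; rewrite mul0r addr0.
by rewrite ltr_pwDl ?mulr_ge0 ?(ltW b_gt0).
Qed.

Lemma spectrum_abs_sum_le z l :
  spectrum p z l ->
  \sum_i `|l i| <= \sum_i grad p (@ones R n) i * `|z i|.
Proof.
move=> zl; apply/ler_addgt0Pl => e e_gt0.
(* The gradient sums to [n], so the shift below costs [2 n d < e]. *)
pose d := e / (n%:R + n%:R + 1).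
have n2_gt0 : 0 < n%:R + n%:R + 1 :> R by rewrite ltr_wpDl ?addr_ge0.
have d_gt0 : 0 < d by rewrite divr_gt0.
(* Positive and negative parts of [z], shifted by [d] to make [u] strictly positive: [u - w = z] and
   [u + w = |z| + 2 d]. *)
pose u i := (`|z i| + z i) / 2 + d; pose w i := (`|z i| - z i) / 2 + d.
have [b ub] := exists_spectrum (fun i => u i + w i).
have u_gt0 i : 0 < u i.
  by rewrite ltr_wpDl// divr_ge0// -lerBlDr sub0r -normrN ler_norm.
have w_ge0 i : 0 <= w i.
  by rewrite addr_ge0 ?(ltW d_gt0)// divr_ge0// subr_ge0 ler_norm.
have b_ge0 : forall i, 0 <= b i.
  by apply: spectrum_ge0 ub _ => i; rewrite addr_ge0 ?(ltW (u_gt0 i)).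
have specE v k : spectrum p v k -> forall y,
    \prod_i `|(y +i* k i)%C| = `|P.@[fun i => (y +i* v i)%C]|.
  move=> vk y; have yE c : (y +i* c)%C = (y%:C)%C + 'i%C * (c%:C)%C.
    by apply/eqP; rewrite eq_complex /=; apply/andP; split; apply/eqP; ring.
  rewrite (meval_eq _ (fun i => yE (v i))) vk normr_prod.
  by apply: eq_bigr => i _; rewrite yE.
apply: le_trans (ler_sum_of_ler_prod_norm b_ge0 _) _ => [y|].
  rewrite (specE _ _ zl) (specE _ _ ub).
  apply: le_trans _ (stable_norm_le y u_gt0 w_ge0).
  have zE i : (y +i* z i)%C = (y +i* (u i - w i))%C.
    by congr (_ +i* _)%C; rewrite /u /w; field.
  by rewrite (meval_eq _ zE).
rewrite (spectrum_trace ub).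
rewrite (eq_bigr (fun i => grad p (@ones R n) i * `|z i| + grad p (@ones R n) i
  * (d + d))); last first.
  by move=> i _; rewrite -mulrDr /u /w; congr (_ * _); field.
rewrite big_split /= addrC lerD2r -mulr_suml sum_grad.
have : d * (n%:R + n%:R + 1) = e by rewrite divfK ?gt_eqF.
by move: d_gt0; lra.
Qed.

End Stable.

(** * The capacity bound *)

Lemma max0_abs (R : realFieldType) (a : R) : Num.max 0 a = (a + `|a|) / 2.
Proof. by have [a_ge0|/ltW a_le0] := leP 0 a;
  [rewrite ger0_norm//|rewrite ler0_norm//]; lra. Qed.

Theorem theorem2p1 (R : realType) (n : nat) (p : {mpoly R[n]})
    (n_ge1 : (1 <= n)%N)
    (p_homog : p \is n.-homog)
    (p_stable : real_stable p)
    (p_nonneg : nonneg_coeffs p)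
    (p_ones : p.@[@ones R n] = 1)
    (grad_lt2 : l1norm (fun i => @ones R n i - grad p (@ones R n) i) < 2) :
  capacity p >=
    (1 - l1norm (fun i => @ones R n i - grad p (@ones R n) i) / 2) ^+ n.
Proof.
set d := l1norm _ in grad_lt2 *.
apply: lb_le_inf.
  by exists (p.@[@ones R n] / \prod_(i < n) @ones R n i), (@ones R n) => // i
    /=.
move=> _ [x /= x_gt0 <-].
rewrite ler_pdivlMr ?prodr_gt0//.
have [l xl] := exists_spectrum p_homog p_stable p_ones x.
have px : p.@[x] = \prod_i l i.
  have := spectrum_real 0 xl; rewrite (@meval_eq _ _ _ x) => [->|i];
    last exact: add0r.
  by apply: eq_bigr => i _; rewrite add0r.
have l_gt0 i : 0 < l i.
  rewrite lt_neqAle (spectrum_ge0 p_nonneg p_ones xl) ?andbT => [|j];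
    last exact: ltW.
  apply: contraTneq (meval_gt0 p_nonneg p_ones x_gt0) => li0.
  by rewrite px (bigD1 i)//= -li0 mul0r ltxx.
rewrite px; apply: (@prod_ge_positive_part _ _ _ _ (grad p (@ones R n))) => //.
- by rewrite ltr_pdivrMr ?mul1r.
(* Shifting by a multiple of the all-ones vector shifts the eigenvalues. In [(a + |a|) / 2] the
   trace identity then matches the first terms and the key estimate compares the second. *)
- move=> t; have txl : spectrum p (fun i => t - x i) (fun i => t - l i).
    move=> a b.
    have splitE c : a + b * ((t - c)%:C)%C = a + b * (t%:C)%C + - b * (c%:C)%C.
      by rewrite rmorphB /=; ring.
    rewrite (meval_eq _ (fun i => splitE (x i))) xl.
    by apply: eq_bigr => i _; rewrite splitE.
  have := spectrum_abs_sum_le p_homog p_stable p_nonneg p_ones txl.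
  have := spectrum_trace txl.
  have splitE i : grad p (@ones R n) i * Num.max 0 (t - x i) =
      (grad p (@ones R n) i * (t - x i) + grad p (@ones R n) i * `|t - x i|) /
        2.
    by rewrite max0_abs mulrA mulrDr.
  rewrite (eq_bigr _ (fun i _ => max0_abs (t - l i))) (eq_bigr _ (fun i _ =>
    splitE i)).
  by rewrite -!mulr_suml !big_split /= => ->;
    rewrite ler_pM2r ?invr_gt0 ?ltr0n // lerD2l.
(* The entries of the gradient minus 1 sum to 0, so their positive parts make up exactly half of the
   norm. *)
- rewrite (eq_bigr _ (fun i _ => max0_abs _)) -mulr_suml ler_pM2r ?invr_gt0
    ?ltr0n// big_split /= sumrB.
  rewrite (sum_grad p_homog p_ones) sumr_const card_ord subrr add0r.
  by rewrite /d /l1norm ler_sum// => i _; rewrite distrC.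
Qed.
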